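(* For every $n\in\mathbb N$, $$|\mathcal G_{2n+1}| = |\mathcal G_{2n-1}|+\sigma_0(n).$$
   Context: $\mathbb N=\{1,2,3,\dots\}$ and $[m]=\{1,2,\dots,m\}$. A finite nonempty set $F\subset\mathbb N$ is called Schreier if $\min F\ge |F|$. For $n\ge 0$, $\mathcal G_{2n+1}$ is the collection of all $F\subset[2n+1]$ such that $2n+1\in F$, $F$ is Schreier, and for all $a,b\in F$, if $(a+b)/2\in\mathbb Z$, then $(a+b)/2\in F$. For $n\in\mathbb N$, $\sigma_0(n)$ is the number of positive divisors of $n$. *)

(* Defs.v *)
From mathcomp Require Import all_boot.
From mathcomp Require Import finmap.

Set Implicit Arguments.
Unset Strict Implicit.
Unset Printing Implicit Defensive.

Local Open Scope fset_scope.

(* The value on [fset0] is junk; [fset_minP] characterizes it otherwise. *)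
Definition fset_min (F : {fset nat}) : nat := head 0 (sort leq (enum_fset F)).

Lemma fset_minP (F : {fset nat}) : F != fset0 ->
  fset_min F \in F /\ {in F, forall k, fset_min F <= k}.
Proof.
move=> F0; rewrite /fset_min.
have memF k : (k \in sort leq (enum_fset F)) = (k \in F) by rewrite mem_sort.
have sF := sort_sorted leq_total (enum_fset F).
case: (sort leq _) memF sF => [|m s] memF /= sF.
  by case/fset0Pn: F0 => k; rewrite -memF.
split=> [|k]; first by rewrite -memF mem_head.
rewrite -memF inE => /predU1P[-> //|ks].
by have /allP/(_ k ks) := order_path_min leq_trans sF.
Qed.

(* Here N starts at 1; a set containing 0 fails the test anyway, since then
   fset_min F = 0 < #|` F|. *)
Definition schreier (F : {fset nat}) : bool :=
  (F != fset0) && (#|` F| <= fset_min F).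

Definition midpoint_closed (F : {fset nat}) : bool :=
  [forall a : F, [forall b : F,
    (2 %| val a + val b) ==> ((val a + val b) %/ 2 \in F)]].

Definition interval1 (m : nat) : {fset nat} := [fset k in iota 1 m].

Definition G (m : nat) : {fset {fset nat}} :=
  [fset F in fpowerset (interval1 m) |
    [&& m \in F, schreier F & midpoint_closed F]].

Definition sigma0 (n : nat) : nat := size (divisors n).

(* Main.v *)
Require Import Defs.
From mathcomp Require Import all_boot.
From mathcomp Require Import finmap.
From mathcomp Require Import zify.

(** In a finite midpoint-closed set, consecutive elements have opposite parity,
    and the middle one of three consecutive elements is the midpoint of the
    other two: such a set is an arithmetic progression of odd difference
    [2 e - 1].  With [j + 1] terms and maximum [2 n + 1], its minimum is
    [2 n + 1 + j - 2 e j], so it is Schreier iff [e j <= n].  Hence the members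
    of [G (2 n + 1)] are one singleton and one progression for each divisor [j]
    of each [i = e j <= n]; replacing [n - 1] by [n] adds the divisors of [n]. *)

Lemma midpoint_closedP (F : {fset nat}) :
  reflect {in F &, forall a b, 2 %| a + b -> (a + b) %/ 2 \in F}
          (midpoint_closed F).
Proof.
apply: (iffP forallP) => [cF a b aF bF ab|cF a].
  by have /forallP/(_ [` bF]%fset)/implyP/(_ ab) := cF [` aF]%fset.
by apply/forallP=> b; apply/implyP; apply: cF; apply: valP.
Qed.

Lemma fset_min_eq (F : {fset nat}) x :
  x \in F -> {in F, forall k, x <= k} -> fset_min F = x.
Proof.
move=> xF x_min; have [|mF m_min] := @fset_minP F; first by apply/fset0Pn; exists x.
by apply/eqP; rewrite eqn_leq m_min // x_min.
Qed.

Definition progression (a d k : nat) : {fset nat} :=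
  [fset (a + d * i)%N | i in iota 0 k]%fset.

Lemma progressionP a d k x :
  reflect (exists2 i, i < k & x = a + d * i) (x \in progression a d k).
Proof.
apply: (iffP (imfsetP _ _ _ _)) => -[i /= ik ->]; exists i => //.
  by move: ik; rewrite mem_iota.
by rewrite mem_iota.
Qed.

Lemma card_progression a d k : 0 < d -> #|` progression a d k| = k.
Proof.
move=> d_gt0; rewrite card_in_imfset /=.
  by rewrite undup_id ?size_iota ?iota_uniq.
by move=> i j _ _ /addnI/eqP; rewrite eqn_pmul2l // => /eqP.
Qed.

(** Allows [d = 0]: the singleton member has difference [2 * 0 - 1], which truncates to 0. *)
Lemma card_progression1 a d : #|` progression a d 1| = 1.
Proof.
suff -> : progression a d 1 = [fset a]%fset by rewrite cardfs1.
by apply/fsetP=> x; rewrite inE; apply/progressionP/eqP => [[[]//]|->];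
  [rewrite muln0 addn0|exists 0; rewrite ?muln0 ?addn0].
Qed.

Lemma fset_min_progression a d k : fset_min (progression a d k.+1) = a.
Proof.
apply: fset_min_eq => [|_ /progressionP[i _ ->]]; last exact: leq_addr.
by apply/progressionP; exists 0; rewrite ?muln0 ?addn0.
Qed.

(** For odd [d], terms with an even sum have indices of equal parity, so their midpoint is the term
    of index [(i + j) %/ 2]. The case [k <= 1] covers singletons of even difference. *)
Lemma midpoint_closed_progression a d k :
  odd d || (k <= 1) -> midpoint_closed (progression a d k).
Proof.
move=> dk; apply/midpoint_closedP.
move=> _ _ /progressionP[i ik ->] /progressionP[j jk ->] even_sum.
apply/progressionP; exists ((i + j) %/ 2); first by lia.
have even_ij : 2 %| i + j.
  move: even_sum; rewrite !dvdn2 !oddD !oddM.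
  by case/orP: dk => [->|k1]; [case: (odd a) (odd i) (odd j) => [] [] []|lia].
have -> : a + d * i + (a + d * j) = (a + d * ((i + j) %/ 2)) * 2.
  by rewrite mulnDl -mulnA divnK //; lia.
by rewrite mulnK.
Qed.

(** Induction on the list: the tail is closed because midpoints of elements above [x] stay above
    [x]. An even first gap would put a midpoint strictly between two neighbours. *)
Lemma sorted_midpoint_closed (s : seq nat) : sorted ltn s ->
    {in s &, forall a b, 2 %| a + b -> (a + b) %/ 2 \in s} ->
  exists2 d, odd d & s = [seq head 0 s + d * i | i <- iota 0 (size s)].
Proof.
elim: s => [|x s IHs] /= s_sorted cs; first by exists 1.
have ltxs : {in s, forall y, x < y}.
  by apply/allP; apply: order_path_min s_sorted; apply: ltn_trans.
have closed_s : {in s &, forall a b, 2 %| a + b -> (a + b) %/ 2 \in s}.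
  move=> a b sa sb ab.
  have := cs a b (mem_behead (s := x :: s) sa) (mem_behead (s := x :: s) sb) ab.
  rewrite inE => /predU1P[mid_x|//].
  by have := ltxs a sa; have := ltxs b sb; lia.
have {IHs} [d d_odd def_s] := IHs (path_sorted s_sorted) closed_s.
case: s => [|y s] in s_sorted cs ltxs closed_s def_s *.
  by exists 1; rewrite //= muln0 addn0.
have ltxy : x < y by apply: ltxs; rewrite mem_head.
have ys : {in s, forall z, y < z}.
  apply/allP; apply: order_path_min ltn_trans _.
  by case/andP: s_sorted.
have odd_xy : odd (y - x).
  apply/negPn/negP => even_xy.
  have := cs x y (mem_head _ _).
  rewrite !inE eqxx orbT => /(_ isT).
  have -> : 2 %| x + y by lia.
  by move=> /(_ isT)/or3P[/eqP|/eqP|/ys]; lia.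
(* A one-element tail leaves [d] undetermined, so the gaps are compared only when a third element
   exists. *)
suff eq_d : s = [::] \/ d = y - x.
  exists (y - x) => //=; rewrite muln0 addn0; congr (_ :: _).
  rewrite muln1 subnKC 1?ltnW //; congr (_ :: _).
  case: eq_d => [-> //|eq_d]; move: def_s => /= [_ {1}->].
  rewrite -eq_d -[2]/(1 + 1) [in RHS]iotaDl -map_comp.
  by apply: eq_map => i /=; lia.
case: s => [|z s] in s_sorted cs ltxs closed_s ys def_s *; [by left | right].
move: def_s => /= [_ def_z _]; rewrite muln1 in def_z.
(* Both gaps [y - x] and [z - y = d] are odd, so [x + z] is even; its half lies strictly between [x]
   and [z], hence equals [y]. *)
have := cs x z (mem_head _ _).
rewrite !inE eqxx !orbT => /(_ isT).
have -> : 2 %| x + z by lia.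
have ltyz : y < z by apply: ys; rewrite mem_head.
have zs : {in s, forall t, z < t}.
  apply/allP; apply: order_path_min ltn_trans _.
  by case/and3P: s_sorted.
by move=> /(_ isT)/or4P[/eqP|/eqP|/eqP|/zs]; lia.
Qed.

Lemma midpoint_closed_eq_progression (F : {fset nat}) :
  F != fset0 -> midpoint_closed F ->
  exists2 d, odd d & F = progression (fset_min F) d #|` F|.
Proof.
move=> F0 /midpoint_closedP cF.
have memF : sort leq F =i F by move=> k; rewrite mem_sort.
have sF : sorted ltn (sort leq F).
  by rewrite ltn_sorted_uniq_leq sort_uniq fset_uniq sort_sorted //; apply: leq_total.
have [|d d_odd def_F] := sorted_midpoint_closed _ sF.
  by move=> a b; rewrite !memF; apply: cF.
exists d => //; apply/fsetP => x; rewrite -memF def_F size_sort.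
apply/mapP/progressionP=> -[i ik ->]; exists i => //.
  by move: ik; rewrite mem_iota.
by rewrite mem_iota.
Qed.

(** Having [m] as an element makes [F] nonempty, and then its minimum is at least its cardinality,
    hence positive: this gives the lower bound of [interval1]. *)
Lemma G_P m (F : {fset nat}) :
  reflect [/\ {in F, forall k, k <= m}, m \in F, #|` F| <= fset_min F
            & midpoint_closed F] (F \in G m).
Proof.
rewrite /G !inE /= fpowersetE /schreier.
apply: (iffP and4P) => [[/fsubsetP Fm mF /andP[F0 Fmin] cF]|[Fm mF Fmin cF]].
  by split=> // k /Fm; rewrite inE mem_iota => /andP[].
have F0 : F != fset0 by apply/fset0Pn; exists m.
split=> //; last by rewrite F0.
apply/fsubsetP=> k kF; rewrite inE /= mem_iota add1n ltnS Fm // andbT.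
have [_ /(_ k kF)] := fset_minP F0; apply: leq_trans.
by apply: leq_trans Fmin; rewrite cardfs_gt0.
Qed.

(* The pair [(i, j)] stands for [j + 1] terms of difference [2 (i / j) - 1].
   Since [0 / 0] is [0], the pair [(0, 0)] gives the singleton. *)
Definition G_index (n : nat) : seq (nat * nat) :=
  (0, 0) :: [seq (i, j) | i <- iota 1 n, j <- divisors i].

Definition G_member (n : nat) (p : nat * nat) : {fset nat} :=
  progression (2 * n + 1 + p.2 - 2 * p.1) (2 * (p.1 %/ p.2) - 1) p.2.+1.

Lemma G_indexP n i j :
  reflect ((i, j) = (0, 0) \/ 0 < i <= n /\ j %| i) ((i, j) \in G_index n).
Proof.
rewrite inE; apply: (iffP predU1P) => -[-> | H]; [by left| |by left|]; right.
  case/allpairsPdep: H => k [l [+ + [-> ->]]].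
  by rewrite mem_iota add1n ltnS => k_in; rewrite -dvdn_divisors //; case/andP: k_in.
case: H => i_in ji; apply/allpairsPdep; exists i, j.
by rewrite mem_iota add1n ltnS -dvdn_divisors //; case/andP: i_in.
Qed.

Lemma size_G_index n : size (G_index n.+1) = size (G_index n) + sigma0 n.+1.
Proof.
have size_index k : size (G_index k) = (sumn [seq sigma0 i | i <- iota 1 k]).+1.
  by rewrite -(size_allpairs_dep pair).
by rewrite !size_index -[n.+1]addn1 iotaD map_cat sumn_cat /= addn0 add1n addn1.
Qed.

Lemma G_index_uniq n : uniq (G_index n).
Proof.
apply/andP; split.
  by apply/negP => /allpairsPdep[k [l [+ _ [k0 _]]]]; rewrite mem_iota -k0.
by apply: allpairs_uniq_dep; [exact: iota_uniq|move=> i _; exact: divisors_uniq|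
  move=> [i j] [k l] _ _ [-> ->]].
Qed.

Lemma card_G_member n i j : (i, j) \in G_index n -> #|` G_member n (i, j)| = j.+1.
Proof.
case/G_indexP=> [[-> ->]|[/andP[i_gt0 _] /dvdnP[e def_i]]].
  exact: card_progression1.
by apply: card_progression; rewrite /= def_i mulnK; nia.
Qed.

(** The cardinality recovers [j], and then the minimum recovers [i], since [i <= n] keeps its
    subtraction from truncating. *)
Lemma G_member_inj n : {in G_index n &, injective (G_member n)}.
Proof.
move=> [i j] [k l] ij kl eq_m.
have := congr1 fset_min eq_m; rewrite !fset_min_progression /=.
have := congr1 (fun F : {fset nat} => #|` F|) eq_m; rewrite !card_G_member // => -[<-].
have le_in i' j' : (i', j') \in G_index n -> i' <= n.
  by case/G_indexP=> [[-> //]|[/andP[]]].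
by move: (le_in _ _ ij) (le_in _ _ kl) => i_n k_n min_eq; congr (_, _); lia.
Qed.

Lemma G_member_in n p : p \in G_index n -> G_member n p \in G (2 * n + 1).
Proof.
case: p => i j ij; have card_ij := card_G_member _ _ _ ij.
(* Treats both kinds of pairs at once, with [e = 0] for the singleton. *)
have [e [def_i i_n j0]] : exists e, [/\ i = e * j, i <= n & 0 < e \/ j = 0].
  case/G_indexP: ij => [[-> ->]|[/andP[i_gt0 i_n] /dvdnP[e def_i]]].
    by exists 0; split=> //; right.
  by exists e; split=> //; left; case: e def_i => //; lia.
(* The term of index [j], the last one, is [2 * n + 1]. *)
have top : 2 * n + 1 = (2 * n + 1 + j - 2 * i) + (2 * (i %/ j) - 1) * j.
  case: j0 => [e_gt0|j0]; last by rewrite j0 muln0; nia.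
  case: (posnP j) => [j0|j_gt0]; first by rewrite j0 muln0; nia.
  by rewrite def_i mulnK //; nia.
apply/G_P; split.
- move=> _ /progressionP[h hj ->] /=.
  by rewrite [leqRHS]top leq_add2l leq_mul2l -ltnS hj orbT.
- by apply/progressionP; exists j.
- by rewrite card_ij fset_min_progression /=; lia.
apply: midpoint_closed_progression => /=.
case: (posnP j) => [-> |j_gt0]; first by rewrite orbT.
by rewrite def_i mulnK //; lia.
Qed.

Lemma G_in_members n F : F \in G (2 * n + 1) -> F \in map (G_member n) (G_index n).
Proof.
case/G_P=> F_le topF F_schreier cF.
have F0 : F != fset0 by apply/fset0Pn; exists (2 * n + 1).
have [d d_odd] := midpoint_closed_eq_progression _ F0 cF.
move: F_schreier; set a := fset_min F.
have : 0 < #|` F| by rewrite cardfs_gt0.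
case: #|` F| => // j _ ja def_F.
have top : 2 * n + 1 = a + d * j.
  apply/eqP; rewrite eqn_leq F_le ?andbT; last first.
    by rewrite def_F; apply/progressionP; exists j.
  move: topF; rewrite def_F => /progressionP[h hj ->].
  by rewrite leq_add2l leq_mul2l -ltnS hj orbT.
pose e := d.+1 %/ 2; have def_d : d = 2 * e - 1 by rewrite /e; lia.
have e_gt0 : 0 < e by rewrite /e; lia.
(* Substituting [a = 2 * n + 1 - (2 * e - 1) * j] into the Schreier bound [j + 1 <= a] gives
   [e * j <= n]. *)
apply/mapP; exists (e * j, j).
  apply/G_indexP; case: (posnP j) => [->|j_gt0]; [left; by rewrite muln0|right].
  by rewrite dvdn_mull // muln_gt0 e_gt0 j_gt0; split=> //; nia.
rewrite def_F /G_member /=.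
(* For [j = 0] the two differences may disagree, but both progressions consist of [a] alone. *)
case: (posnP j) => [j0|j_gt0].
  rewrite j0 muln0 div0n.
  have -> : 2 * n + 1 + 0 - 2 * 0 = a by move: top; rewrite j0; lia.
  by apply/fsetP=> x; apply/progressionP/progressionP=> -[[|//] _ ->]; exists 0;
    rewrite ?muln0.
by rewrite mulnK // -def_d; congr progression; nia.
Qed.

Lemma mem_G n F : (F \in G (2 * n + 1)) = (F \in map (G_member n) (G_index n)).
Proof.
apply/idP/idP; first exact: G_in_members.
by case/mapP=> p p_in ->; apply: G_member_in.
Qed.

Lemma card_G n : #|` G (2 * n + 1)| = size (G_index n).
Proof.
rewrite -(size_map (G_member n)); apply/perm_size/uniq_perm.
- exact: fset_uniq.
- by rewrite map_inj_in_uniq ?G_index_uniq //; apply: G_member_inj.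
- exact: mem_G.
Qed.

Theorem theorem1p5 (n : nat) (n_gt0 : 0 < n) :
  #|` G (2 * n + 1)| = #|` G (2 * n - 1)| + sigma0 n.
Proof.
case: n n_gt0 => // n _; have -> : 2 * n.+1 - 1 = 2 * n + 1 by lia.
by rewrite !card_G size_G_index.
Qed.
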